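(* (a) Every $N$-affine equivariant additive integrator map $\phi$ is closed under differentiation: $\phi(\delta f^{[1]},\ldots,\delta f^{[N]})=\delta\phi(f^{[1]},\ldots,f^{[N]})$ for every Banach space $Y$ and all $f^{[1]},\ldots,f^{[N]}\in\mathfrak X(Y)$. (b) Every P-affine equivariant partitioned integrator map $\phi$ is closed under differentiation: $\phi(\delta f)=\delta\phi(f)$ for every partitioned Banach space $Y=\bigoplus_\nu Y^{[\nu]}$ and every $f\in\mathfrak X(Y)$, where $Y\times Y$ is partitioned as $\bigoplus_\nu(Y^{[\nu]}\times Y^{[\nu]})$.
   Context: All spaces are real Banach spaces; $\mathfrak X(Y)$ denotes smooth vector fields on $Y$. For $f\in\mathfrak X(Y)$, $\delta f\in\mathfrak X(Y\times Y)$ is $\delta f(y,\eta)=(f(y),f'(y)\eta)$. $f\sim_\chi g$ means $\chi'(y)f(y)=g(\chi(y))$ for all $y$. Fix $N$. An additive integrator map is a collection of smooth maps $\phi_Y\colon\mathfrak X(Y)^N\to\mathfrak X(Y)$, one per Banach space; it is $N$-affine equivariant if for every affine map $A$ between Banach spaces, $f^{[\nu]}\sim_A g^{[\nu]}$ for all $\nu$ implies $\phi(f^{[1]},\ldots,f^{[N]})\sim_A\phi(g^{[1]},\ldots,g^{[N]})$. A partitioned Banach space is $Y=Y^{[1]}\oplus\cdots\oplus Y^{[N]}$; a partitioned integrator map is a collection of smooth maps $\phi\colon\mathfrak X(Y)\to\mathfrak X(Y)$, one per partitioned space. $A\colon Y\to U$ is P-affine if $A=\bigoplus_\nu A^{[\nu]}$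 with each $A^{[\nu]}\colon Y^{[\nu]}\to U^{[\nu]}$ affine; a partitioned integrator map is P-affine equivariant if $f\sim_A g$ implies $\phi(f)\sim_A\phi(g)$ for all P-affine $A$. *)

(* Defs.v *)
From HB Require Import structures.
From mathcomp Require Import all_boot all_algebra.
From mathcomp Require Import all_classical all_reals all_analysis.
Import numFieldNormedType.Exports.
Import GRing.Theory Num.Theory.

Set Implicit Arguments.
Unset Strict Implicit.
Unset Printing Implicit Defensive.

Local Open Scope ring_scope.
Local Open Scope classical_set_scope.

Section Defs.
Variable R : realType.

Definition banach (Y : normedModType R) : Prop :=
  forall F : set_system Y, ProperFilter F -> cauchy F -> exists l : Y, F --> l.

Definition Tmap (U V : normedModType R) (f : U -> V) : U * U -> V * V :=
  fun p => (f p.1, 'd f (p.1) p.2).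

Definition delta (Y : normedModType R) (f : Y -> Y) : Y * Y -> Y * Y :=
  Tmap f.

(** C^n via iterated tangent maps; smooth = C^infinity. *)
Fixpoint smooth_n (n : nat) (U V : normedModType R) (f : U -> V) : Prop :=
  match n with
  | O => True
  | S m => (forall x, differentiable f x) /\ smooth_n m (Tmap f)
  end.

Definition smooth (U V : normedModType R) (f : U -> V) : Prop :=
  forall n, smooth_n n f.

Definition related (U V : normedModType R) (chi : U -> V)
  (f : U -> U) (g : V -> V) : Prop :=
  forall y, 'd chi y (f y) = g (chi y).

Definition is_linear (U V : normedModType R) (L : U -> V) : Prop :=
  forall (a : R) (x y : U), L (a *: x + y) = a *: L x + L y.

Definition affine (U V : normedModType R) (A : U -> V) : Prop :=
  exists L : U -> V, [/\ is_linear L, continuous L &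
    exists b : V, forall x, A x = L x + b].

Definition smooth_family (Y : normedModType R) (F : R -> Y -> Y) : Prop :=
  smooth (fun p : R^o * Y => F p.1 p.2).

Definition additive_map (N : nat) :=
  forall Y : normedModType R, ('I_N -> Y -> Y) -> Y -> Y.

(** phi_Y : X(Y)^N -> X(Y) is a smooth map: it sends smooth fields to smooth
    fields and smooth families of inputs to smooth families of outputs. *)
Definition additive_integrator_map (N : nat) (phi : additive_map N) : Prop :=
  forall Y : normedModType R, banach Y ->
    (forall f : 'I_N -> Y -> Y, (forall i, smooth (f i)) -> smooth (phi Y f))
    /\ (forall F : 'I_N -> R -> Y -> Y, (forall i, smooth_family (F i)) ->
          smooth_family (fun t => phi Y (fun i => F i t))).

Definition N_affine_equivariant (N : nat) (phi : additive_map N) : Prop :=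
  forall (U V : normedModType R), banach U -> banach V ->
  forall A : U -> V, affine A ->
  forall (f : 'I_N -> U -> U) (g : 'I_N -> V -> V),
    (forall i, smooth (f i)) -> (forall i, smooth (g i)) ->
    (forall i, related A (f i) (g i)) -> related A (phi U f) (phi V g).

(** A partition Y = Y^[1] (+) ... (+) Y^[N] of a Banach space, given by the
    bounded projections P i onto the summands Y^[i]. *)
Definition is_partition (N : nat) (Y : normedModType R) (P : 'I_N -> Y -> Y)
  : Prop :=
  [/\ forall i, is_linear (P i) /\ continuous (P i),
      forall i j x, P i (P j x) = (if i == j then P i x else 0) &
      forall x, \sum_(i < N) P i x = x].

Definition partition_pair (N : nat) (Y : normedModType R) (P : 'I_N -> Y -> Y)
  : 'I_N -> Y * Y -> Y * Y :=
  fun i p => (P i p.1, P i p.2).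

(** A = (+)_nu A^[nu] with A^[nu] : Y^[nu] -> U^[nu] affine *)
Definition P_affine (N : nat) (Y U : normedModType R)
  (P : 'I_N -> Y -> Y) (Q : 'I_N -> U -> U) (A : Y -> U) : Prop :=
  exists L : Y -> U, [/\ is_linear L, continuous L,
    forall i x, L (P i x) = Q i (L x) &
    exists b : U, forall x, A x = L x + b].

Definition partitioned_map (N : nat) :=
  forall Y : normedModType R, ('I_N -> Y -> Y) -> (Y -> Y) -> Y -> Y.

Definition partitioned_integrator_map (N : nat) (phi : partitioned_map N)
  : Prop :=
  forall (Y : normedModType R) (P : 'I_N -> Y -> Y),
    banach Y -> is_partition P ->
    (forall f : Y -> Y, smooth f -> smooth (phi Y P f))
    /\ (forall F : R -> Y -> Y, smooth_family F ->
          smooth_family (fun t => phi Y P (F t))).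

Definition P_affine_equivariant (N : nat) (phi : partitioned_map N) : Prop :=
  forall (Y U : normedModType R) (P : 'I_N -> Y -> Y) (Q : 'I_N -> U -> U),
    banach Y -> banach U -> is_partition P -> is_partition Q ->
  forall A : Y -> U, P_affine P Q A ->
  forall (f : Y -> Y) (g : U -> U), smooth f -> smooth g ->
    related A f g -> related A (phi Y P f) (phi U Q g).

End Defs.

(* Main.v *)
(** For a smooth field [f], the fields
    [G_t (y, eta) = (f y, int_0^1 f'(y + s t eta) eta ds)] on [Y * Y] form a
    smooth family with [G_0 = delta f], and
    [t *: (G_t (y, eta)).2 = f (y + t eta) - f y]. Hence [G_t] is related to [f]
    by both affine maps [(y, eta) |-> y] and [(y, eta) |-> y + t eta], and
    equivariance shows that [phi G_t] has components [phi f y] and, for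
    [t != 0], [(phi f (y + t eta) - phi f y) / t]. Since [phi] maps smooth
    families to smooth families, the claim follows by letting [t] tend to [0].

    Smoothness of [G] follows from that of
    [M f (y, z) = int_0^1 f (y + s z) ds]: the tangent map of [M f] is
    [M (Tmap f)] up to reordering the arguments, so one differentiation under
    the integral sign suffices. *)

Require Import Defs.
From HB Require Import structures.
From mathcomp Require Import all_boot all_order all_algebra.
From mathcomp Require Import all_classical all_reals all_analysis.
From mathcomp Require Import ring lra.
Import numFieldNormedType.Exports.
Import Order.TTheory GRing.Theory Num.Theory.

Set Implicit Arguments.
Unset Strict Implicit.
Unset Printing Implicit Defensive.

Local Open Scope ring_scope.
Local Open Scope classical_set_scope.

(** * Calculus of smooth maps *)

Section Smooth.
Variable R : realType.
Implicit Types U V W X : normedModType R.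

Lemma continuous_linear_diff U V (L : U -> V) x :
  is_linear L -> continuous L -> differentiable L x /\ 'd L x = L :> (U -> V).
Proof.
move=> linL cL.
pose L' : {linear U -> V} := HB.pack L (GRing.isLinear.Build _ _ _ _ _ linL).
split; first exact: (@linear_differentiable _ _ _ L').
exact: (@diff_lin _ _ _ L').
Qed.

Lemma diff_approx U V (f : U -> V) (x : U) (e : R) :
  differentiable f x -> 0 < e ->
  exists2 r : R, 0 < r & forall h : U, `|h| < r ->
    `|f (h + x) - f x - 'd f x h| <= e * `|h|.
Proof.
move=> /diff_locally/eqaddoP fx e0.
have /nbhs_norm0P[r /= r0 H] := fx e e0.
exists r => // h hr; have := H h hr.
by rewrite -![(_ + _ : _ -> _) _]/(_ + _)
  -![(- _ : _ -> _) _]/(- _) /= opprD addrA.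
Qed.

(** The bound by [K] makes the candidate [L] continuous, as differentiability demands; uniqueness of
    the differential then identifies it. *)
Lemma diff_of_approx U V (f : U -> V) (x : U) (L : U -> V) (K : R) :
  is_linear L -> (forall h, `|L h| <= K * `|h|) ->
  (forall e, 0 < e -> exists2 r : R, 0 < r & forall h : U, `|h| < r ->
    `|f (h + x) - f x - L h| <= e * `|h|) ->
  differentiable f x /\ 'd f x = L :> (U -> V).
Proof.
move=> linL LK fL.
pose L' : {linear U -> V} := HB.pack L (GRing.isLinear.Build _ _ _ _ _ linL).
have cL : continuous L.
  apply: (@bounded_linear_continuous _ _ _ L'); apply/linear_boundedP.
  exists K; split=> [|r /ltW Kr z]; first exact: num_real.
  by apply: (le_trans (LK z)); exact: ler_wpM2r.
have E : f \o shift x = cst (f x) + L' +o_ 0 id.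
  apply/eqaddoP => e e0; apply/nbhs_norm0P.
  have [r r0 H] := fL e e0; exists r => // h hr; have := H h hr.
  by rewrite -![(_ + _ : _ -> _) _]/(_ + _)
  -![(- _ : _ -> _) _]/(- _) /= opprD addrA.
have D : 'd f x = L :> (U -> V) by apply: (@diff_unique _ _ _ f L').
split=> //; apply/diff_locallyP; rewrite D; split=> //; exact: E.
Qed.

Lemma diff_bounded U V (f : U -> V) (x : U) : differentiable f x ->
  exists2 K : R, 0 < K & forall h, `|'d f x h| <= K * `|h|.
Proof. by move=> df; apply: linear_lipschitz; exact: diff_continuous. Qed.

Lemma smooth_differentiable U V (f : U -> V) (x : U) :
  smooth f -> differentiable f x.
Proof. by move=> /(_ 1%N)[]. Qed.

Lemma smooth_Tmap U V (f : U -> V) : smooth f -> smooth (Tmap f).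
Proof. by move=> sf n; have [] := sf n.+1. Qed.

Lemma continuous_pair U V W (f : U -> V) (g : U -> W) :
  continuous f -> continuous g -> continuous (fun x => (f x, g x)).
Proof. by move=> cf cg x; apply: cvg_pair; [exact: cf|exact: cg]. Qed.

Lemma continuous_comp_fst U V W (f : U -> W) :
  continuous f -> continuous (fun p : U * V => f p.1).
Proof. by move=> cf x; apply: cvg_comp; [exact: cvg_fst|exact: cf]. Qed.

Lemma continuous_comp_snd U V W (f : V -> W) :
  continuous f -> continuous (fun p : U * V => f p.2).
Proof. by move=> cf x; apply: cvg_comp; [exact: cvg_snd|exact: cf]. Qed.

(** The tangent map of [L] is [L] on both components, again linear and continuous, so the induction
    closes. *)
Lemma smooth_n_linear n U V (L : U -> V) :
  is_linear L -> continuous L -> smooth_n n L.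
Proof.
elim: n U V L => [|n IH] U V L linL cL //=.
split=> [x|]; first by have [] := continuous_linear_diff x linL cL.
have -> : Tmap L = fun p : U * U => (L p.1, L p.2).
  apply/funext => p; rewrite /Tmap.
  by have [_ ->] := continuous_linear_diff p.1 linL cL.
apply: IH.
  by move=> a [x1 x2] [y1 y2] /=; rewrite !linL.
by apply: continuous_pair;
  [exact: continuous_comp_fst|exact: continuous_comp_snd].
Qed.

Lemma smooth_n_comp n U V W (f : U -> V) (g : V -> W) :
  smooth_n n f -> smooth_n n g -> smooth_n n (g \o f).
Proof.
elim: n U V W f g => [|n IH] U V W f g //= [df sf] [dg sg].
split=> [x|]; first exact: differentiable_comp.
have -> : Tmap (g \o f) = Tmap g \o Tmap f.
  by apply/funext => p; rewrite /Tmap /= diff_comp.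
exact: IH.
Qed.

Lemma smooth_n_fst n U V : smooth_n n (@fst U V).
Proof. by apply: smooth_n_linear => // p; exact: cvg_fst. Qed.

Lemma smooth_n_snd n U V : smooth_n n (@snd U V).
Proof. by apply: smooth_n_linear => // p; exact: cvg_snd. Qed.

(** Exchange of the middle factors: it turns a pair of tangent vectors into a tangent vector of the
    product, and back. *)
Definition swap4 U V W X (p : (U * V) * (W * X)) : (U * W) * (V * X) :=
  ((p.1.1, p.2.1), (p.1.2, p.2.2)).

Lemma smooth_n_swap4 n U V W X : smooth_n n (@swap4 U V W X).
Proof.
apply: smooth_n_linear => //.
by apply: continuous_pair; apply: continuous_pair;
  do ?[apply: continuous_comp_fst|apply: continuous_comp_snd];
  move=> p; (exact: cvg_fst || exact: cvg_snd).
Qed.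

Lemma smooth_n_pair n U V W (f : U -> V) (g : U -> W) :
  smooth_n n f -> smooth_n n g -> smooth_n n (fun x => (f x, g x)).
Proof.
elim: n U V W f g => [|n IH] U V W f g //= [df sf] [dg sg].
split=> [x|]; first exact: differentiable_pair.
have -> : Tmap (fun x => (f x, g x)) =
    @swap4 V V W W \o (fun p => (Tmap f p, Tmap g p)).
  by apply/funext => p; rewrite /Tmap /= diff_pair.
by apply: smooth_n_comp; [exact: IH|exact: smooth_n_swap4].
Qed.

Lemma smooth_n_add n U V (f g : U -> V) :
  smooth_n n f -> smooth_n n g -> smooth_n n (fun x => f x + g x).
Proof.
move=> sf sg.
apply: (@smooth_n_comp n _ _ _ (fun x => (f x, g x))
  (fun q : V * V => q.1 + q.2)).
  exact: smooth_n_pair.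
apply: smooth_n_linear.
  by move=> a [x1 x2] [y1 y2] /=; rewrite scalerDr addrACA.
by move=> p; exact: add_continuous.
Qed.

(** By the product rule, the tangent map is assembled from projections, sums and scalar
    multiplication itself, to which the induction hypothesis applies. *)
Lemma smooth_n_scale n V : smooth_n n (fun p : R^o * V => p.1 *: p.2).
Proof.
elim: n => [//|n IH].
have cs : continuous (fun p : R^o * V => p.1 *: p.2).
  by move=> p; exact: scale_continuous.
have bil : bilinear_for (GRing.Scale.Law.clone _ _ *:%R _)
    (GRing.Scale.Law.clone _ _ *:%R _) (fun (a : R^o) (v : V) => a *: v).
  split=> [v a x y|a b x y] /=; first by rewrite scalerDl scalerA.
  by rewrite scalerDr !scalerA mulrC.
pose s' : {bilinear R^o -> V -> V} := HB.pack (fun (a : R^o) (v : V) => a *: v)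
  (bilinear_isBilinear.Build _ _ _ _ _ _ (fun (a : R^o) (v : V) => a *: v) bil).
split=> [p|]; first exact: (@differentiable_bilin _ _ _ _ s').
have -> : Tmap (fun p : R^o * V => p.1 *: p.2) =
    (fun q => (q.1.1 *: q.1.2, q.1.1 *: q.2.2 + q.2.1 *: q.1.2)).
  by apply/funext => q; rewrite /Tmap /= (@diff_bilin _ _ _ _ s').
have c11 : smooth_n n (fun q : (R^o * V) * (R^o * V) => q.1.1).
  by apply: (@smooth_n_comp n _ _ _ fst fst); exact: smooth_n_fst.
have c12 : smooth_n n (fun q : (R^o * V) * (R^o * V) => q.1.2).
  by apply: (@smooth_n_comp n _ _ _ fst snd);
    [exact: smooth_n_fst|exact: smooth_n_snd].
have c21 : smooth_n n (fun q : (R^o * V) * (R^o * V) => q.2.1).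
  by apply: (@smooth_n_comp n _ _ _ snd fst);
    [exact: smooth_n_snd|exact: smooth_n_fst].
have c22 : smooth_n n (fun q : (R^o * V) * (R^o * V) => q.2.2).
  by apply: (@smooth_n_comp n _ _ _ snd snd); exact: smooth_n_snd.
have sc (a : (R^o * V) * (R^o * V) -> R^o) (b : (R^o * V) * (R^o * V) -> V) :
    smooth_n n a -> smooth_n n b -> smooth_n n (fun q => a q *: b q).
  move=> sa sb.
  exact: (smooth_n_comp (smooth_n_pair sa sb) IH).
by apply: smooth_n_pair; [exact: sc|apply: smooth_n_add; exact: sc].
Qed.

End Smooth.

(** * Strict differentiability *)

Section C1.
Variable R : realType.
Implicit Types U V W X : normedModType R.

(** [smooth] only asks for pointwise differentiability of iterated tangent maps;
    continuity of the differential in operator norm comes from differentiating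
    [Tmap f] at [(x, 0)] and rescaling [v]. *)
Lemma smooth_diff_cont U V (f : U -> V) (x : U) (e : R) : smooth f -> 0 < e ->
  exists2 r : R, 0 < r & forall z : U, `|z - x| < r ->
    forall v, `|'d f z v - 'd f x v| <= e * `|v|.
Proof.
move=> sf e0.
have e30 : 0 < e / 3 by lra.
have [r r0 H] :=
  diff_approx (smooth_differentiable (x, 0) (smooth_Tmap sf)) e30.
set D := 'd (Tmap f) (x, 0) in H.
(* Second component of the expansion of [Tmap f] at [(x, 0)], where its value is ['d f x 0 = 0]. *)
have H2 (h v : U) : `|h| < r -> `|v| < r ->
    `|'d f (h + x) v - (D (h, v)).2| <= e / 3 * Num.max `|h| `|v|.
  move=> hr vr; have := H (h, v); rewrite !prod_normE/= gt_max hr vr => /(_ isT).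
  rewrite ge_max => /andP[_]; rewrite /Tmap /= addr0 linear0 subr0.
  by apply.
have r20 : 0 < r / 2 by lra.
exists (r / 2) => // z zx v.
pose h := z - x; have zE : z = h + x by rewrite subrK.
(* On the sphere of radius [r / 2], the expansions for the increments [(h, w)], [(h, 0)] and
   [(0, w)] are combined through additivity of [D]; each costs at most [e / 3 * (r / 2)]. *)
have key w : `|w| = r / 2 -> `|'d f z w - 'd f x w| <= e * (r / 2).
  move=> wr; have hr : `|h| < r by rewrite /h; lra.
  have wr' : `|w| < r by lra.
  have A := H2 h w hr wr'.
  have B := H2 h 0 hr; have C := H2 0 w _ wr'.
  rewrite normr0 in B C; move: (B r0) (C r0) => {}B {}C.
  rewrite linear0 sub0r normrN add0r in B C.
  have hw : Num.max `|h| `|w| = r / 2 by rewrite wr; apply/max_idPr/ltW.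
  rewrite (max_idPl (normr_ge0 _)) in B; rewrite (max_idPr (normr_ge0 _)) in C.
  have DE : (D (h, w)).2 = (D (h, 0)).2 + (D (0, w)).2.
    by rewrite -[in LHS](addr0 h) -[w in LHS]add0r
      -[(_ + _, _)]/((h, 0) + (0, w)) linearD.
  rewrite hw -zE DE in A; rewrite wr in C.
  have -> : 'd f z w - 'd f x w = ('d f z w - ((D (h, 0)).2 + (D (0, w)).2))
      + (D (h, 0)).2 - ('d f x w - (D (0, w)).2).
    by rewrite opprB addrA -(addrA _ (D (h, 0)).2) subrK.
  apply: le_trans (ler_normB _ _) _.
  have := ler_normD ('d f z w - ((D (h, 0)).2 + (D (0, w)).2)) (D (h, 0)).2.
  have : e / 3 * `|h| <= e / 3 * (r / 2).
    by apply: ler_wpM2l; [lra|rewrite /h; lra].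
  by move: A B C; lra.
have [->|v0] := eqVneq v 0; first by rewrite
  ['d f z 0]linear0 ['d f x 0]linear0 subr0 !normr0 mulr0.
have nv : 0 < `|v| by rewrite normr_gt0.
(* Both sides are homogeneous in [v], so [v] is rescaled to norm [r / 2]. *)
pose k := (r / 2) / `|v|; have k0 : 0 < k by rewrite divr_gt0.
have kv : `|k *: v| = r / 2.
  by rewrite normrZ gtr0_norm// divfK// gt_eqF.
have := key _ kv; rewrite ['d f z _]linearZ ['d f x _]linearZ /=.
rewrite -scalerBr normrZ gtr0_norm//.
have -> : e * (r / 2) = k * (e * `|v|).
  by rewrite [RHS]mulrCA /k divfK// gt_eqF.
by rewrite ler_pM2l.
Qed.

(** A supremum argument, since a vector-valued curve need not attain its mean slope: if the supremum
    of the parameters satisfying the bound were below [1], it could be pushed further. *)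
Lemma mean_value_inequality V (c : R -> V) (K : R) :
  (forall t, 0 <= t <= 1 -> exists2 r : R, 0 < r &
    forall s, `|s - t| < r -> `|c s - c t| <= K * `|s - t|) ->
  `|c 1 - c 0| <= K.
Proof.
move=> H.
have K0 : 0 <= K.
  have [|r r0 Hr] := H 0; first by rewrite lexx ler01.
  have r20 : 0 < r / 2 by lra.
  have /Hr : `|r / 2 - 0| < r by rewrite subr0 gtr0_norm//; lra.
  rewrite subr0 (gtr0_norm r20) => /(le_trans (normr_ge0 _)).
  by rewrite pmulr_lge0.
pose S : set R := [set t | 0 <= t <= 1 /\ `|c t - c 0| <= K * t].
have S0 : S 0 by split; [rewrite lexx ler01|rewrite subrr normr0 mulr0].
have supS : has_sup S.
  split; first by exists 0.
  by exists 1 => t [/andP[]].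
pose m := sup S.
have m01 : 0 <= m <= 1.
  apply/andP; split; first exact: sup_upper_bound.
  by apply: ge_sup; [exists 0|move=> t [/andP[]]].
have [r r0 Hr] := H m m01.
(* The supremum itself satisfies the bound, by comparison with a point of [S] at distance less than
   [r]. *)
have Sm : `|c m - c 0| <= K * m.
  have [t St] := sup_adherent r0 supS; rewrite -/m => tm.
  have tm' : t <= m by exact: sup_upper_bound.
  case: St => _ ct.
  have tmr : `|t - m| < r by rewrite ler0_norm; lra.
  have := Hr _ tmr; rewrite distrC ler0_norm; last by lra.
  have -> : c m - c 0 = (c m - c t) + (c t - c 0) by rewrite subrKA.
  move=> cmt; apply: (le_trans (ler_normD _ _)).
  have -> : K * m = K * - (t - m) + K * t by ring.
  by apply: lerD.
have [m1|m1] := ltP m 1; last first.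
  have m1E : m = 1 by lra.
  by move: Sm; rewrite m1E mulr1.
exfalso.
pose s := m + Num.min (r / 2) (1 - m).
have d0 : 0 < Num.min (r / 2) (1 - m) by rewrite lt_min; apply/andP; split; lra.
have dr : Num.min (r / 2) (1 - m) <= r / 2 by rewrite ge_min lexx.
have d1 : Num.min (r / 2) (1 - m) <= 1 - m by rewrite ge_min lexx orbT.
have : S s.
  split; first by rewrite /s; lra.
  have smr : `|s - m| < r by rewrite /s gtr0_norm; lra.
  have := Hr _ smr; rewrite [`|s - m|]gtr0_norm; last by rewrite /s; lra.
  have -> : c s - c 0 = (c s - c m) + (c m - c 0) by rewrite subrKA.
  move=> cmt; apply: (le_trans (ler_normD _ _)).
  have -> : K * s = K * (s - m) + K * m by ring.
  by apply: lerD.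
by move=> /(sup_upper_bound supS); rewrite -/m /s; lra.
Qed.

(** The mean value inequality for [f - L] along the segment. One [e] comes from the first-order
    remainder of [f], the other from replacing ['d f] by [L]. *)
Lemma mean_value_approx U V (f : U -> V) (L : {linear U -> V})
    (x : U) (r e : R) :
  0 < e -> (forall z, differentiable f z) ->
  (forall z : U, `|z - x| < r -> forall v, `|'d f z v - L v| <= e * `|v|) ->
  forall p q : U, `|p - x| < r -> `|q - x| < r ->
  `|f q - f p - L (q - p)| <= 2 * e * `|q - p|.
Proof.
move=> e0 df H p q px qx; set d := q - p.
pose c t := f (t *: d + p) - L (t *: d).
have -> : f q - f p - L d = c 1 - c 0.
  rewrite /c !scale1r !scale0r linear0 add0r subr0 /d subrK.
  by rewrite addrAC.
apply: mean_value_inequality => t /andP[t0 t1].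
have [r' r'0 Hr'] := diff_approx (df (t *: d + p)) e0.
have nd : 0 < `|d| + 1 by rewrite ltr_wpDl.
exists (r' / (`|d| + 1)); first exact: divr_gt0.
move=> s; rewrite ltr_pdivlMr// => st.
(* The ball is convex; [t = 0] is treated apart because a strict inequality multiplied by [t]
   degenerates there. *)
have tx : `|t *: d + p - x| < r.
  have -> : t *: d + p - x = t *: (q - x) + (1 - t) *: (p - x).
    rewrite scalerBl scale1r addrCA -scalerBr opprB subrKA.
    by rewrite -addrA addrC.
  apply: (le_lt_trans (ler_normD _ _)).
  rewrite !normrZ (ger0_norm t0) (@ger0_norm _ (1 - t)); last by lra.
  have [->|tn0] := eqVneq t 0; first by rewrite mul0r add0r subr0 mul1r.
  have tp : 0 < t by rewrite lt_neqAle eq_sym tn0.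
  have : t * `|q - x| < t * r by rewrite ltr_pM2l.
  have : (1 - t) * `|p - x| <= (1 - t) * r by apply: ler_wpM2l; lra.
  by lra.
have sd : `|(s - t) *: d| < r'.
  rewrite normrZ; apply: le_lt_trans st; apply: ler_wpM2l => //; lra.
have := Hr' _ sd; have := H _ tx ((s - t) *: d).
have -> : (s - t) *: d + (t *: d + p) = s *: d + p.
  by rewrite addrA scalerBl subrK.
move=> A B.
have -> : c s - c t = (f (s *: d + p) - f (t *: d + p)
    - 'd f (t *: d + p) ((s - t) *: d))
    + ('d f (t *: d + p) ((s - t) *: d) - L ((s - t) *: d)).
  rewrite subrKA /c scalerBl [L (_ - _)]linearB /=.
  by rewrite !opprB [L _ - f _]addrC addrACA [- L _ + _]addrC.
apply: le_trans (ler_normD _ _) _.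
have -> : 2 * e * `|d| * `|s - t| = e * `|(s - t) *: d| + e * `|(s - t) *: d|.
  by rewrite normrZ; ring.
exact: lerD.
Qed.

(** Strict differentiability: base point and end point both vary near [x]. The mean value estimate
    costs two thirds of [e], passing from ['d f x] to ['d f p] the last third. *)
Lemma smooth_strict_diff U V (f : U -> V) (x : U) (e : R) : smooth f -> 0 < e ->
  exists2 r : R, 0 < r & forall p q : U, `|p - x| < r -> `|q - x| < r ->
    `|f q - f p - 'd f p (q - p)| <= e * `|q - p|.
Proof.
move=> sf e0; have e30 : 0 < e / 3 by lra.
have [r r0 H] := smooth_diff_cont x sf e30.
exists r => // p q px qx.
have df z := smooth_differentiable z sf.
have := mean_value_approx e30 df H px qx.
have := H _ px (q - p).
set a := 'd f p _; set b := 'd f x _ => A B.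
have -> : f q - f p - a = (f q - f p - b) - (a - b).
  by rewrite opprB addrA subrK.
by apply: le_trans (ler_normB _ _) _; lra.
Qed.

(** Compactness of [[0, 1]] turns local radii into a common one. The hypothesis covers all smaller
    radii because [P] need not be monotone in its first argument. *)
Lemma segment_uniform (P : R -> R -> Prop) :
  (forall s0, 0 <= s0 <= 1 -> exists2 r : R, 0 < r &
     forall s r', `|s - s0| < r -> 0 < r' < r -> P r' s) ->
  exists2 r : R, 0 < r & forall s, 0 <= s <= 1 -> P r s.
Proof.
move=> H; have /compact_near_coveringP K := @segment_compact R 0 1.
have : \forall r \near 0^'+, `[0, 1]%classic `<=` P r.
  apply: K => s0; rewrite /= in_itv /= => /H[r r0 Hr].
  exists ([set s | `|s - s0| < r], [set r' | 0 < r' < r]) => /=.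
    split.
      apply/nbhs_normP; exists r => // s /=; by rewrite distrC.
    by apply: filterS2 (nbhs_right_gt 0) (nbhs_right_lt r0) => r' /= -> ->.
  by move=> [s r'] /= [? ?]; apply: Hr.
move=> A; near (0 : R)^'+ => r; exists r.
  by near: r; exact: nbhs_right_gt.
have Pr : `[0, 1]%classic `<=` P r by near: r.
by move=> s s01; apply: Pr; rewrite /= in_itv.
Unshelve. all: by end_near. Qed.

End C1.

(** * Integration over the unit interval *)

Section Integral.
Variable R : realType.
Implicit Types U V W X : normedModType R.

Lemma banach_prod U V : banach U -> banach V -> banach (U * V)%type.
Proof.
move=> bU bV F PF /cauchyP cF.
have [|l1 Fl1] := bU (fst @ F) (fmap_proper_filter _ _).
  apply: cauchy_exP => e e0; have [x Fx] := cF e e0.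
  exists x.1; suff : F [set z | ball x.1 e z.1] by [].
  by apply: filterS Fx => z [].
have [|l2 Fl2] := bV (snd @ F) (fmap_proper_filter _ _).
  apply: cauchy_exP => e e0; have [x Fx] := cF e e0.
  exists x.2; suff : F [set z | ball x.2 e z.2] by [].
  by apply: filterS Fx => z [].
exists (l1, l2).
have := cvg_pair Fl1 Fl2.
rewrite (_ : (fun x : U * V => (x.1, x.2)) = id); last by apply/funext => -[].
exact.
Qed.

(** Left-endpoint sum over [2 ^ n] equal subintervals, arranged by bisection so that estimates pass
    to the two halves by induction. *)
Fixpoint riemann V n (c : R -> V) (a b : R) : V :=
  if n is m.+1 then riemann m c a ((a + b) / 2) + riemann m c ((a + b) / 2) b
  else (b - a) *: c a.

Lemma riemann_linear V n k (c d : R -> V) a b :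
  riemann n (fun s => k *: c s + d s) a b =
  k *: riemann n c a b + riemann n d a b.
Proof.
elim: n a b => [|n IH] a b /=.
  by rewrite scalerDr !scalerA mulrC.
by rewrite !IH scalerDr addrACA.
Qed.

Lemma riemann_pair U V n (c : R -> U) (d : R -> V) a b :
  riemann n (fun s => (c s, d s)) a b = (riemann n c a b, riemann n d a b).
Proof. by elim: n a b => [|n IH] a b //=; rewrite !IH. Qed.

Lemma riemann_cst V n (v : V) a b : riemann n (fun=> v) a b = (b - a) *: v.
Proof.
elim: n a b => [|n IH] a b //=.
by rewrite !IH -scalerDl; congr (_ *: _); field.
Qed.

Lemma riemannB V n (c d : R -> V) a b :
  riemann n (fun s => c s - d s) a b = riemann n c a b - riemann n d a b.
Proof.
have -> : (fun s => c s - d s) = (fun s => (-1) *: d s + c s).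
  by apply/funext => s; rewrite scaleN1r addrC.
by rewrite riemann_linear scaleN1r addrC.
Qed.

Lemma riemann_bound V n (c : R -> V) a b w : a <= b ->
  (forall s, a <= s <= b -> `|c s| <= w) -> `|riemann n c a b| <= w * (b - a).
Proof.
elim: n a b => [|n IH] a b ab H /=.
  rewrite normrZ mulrC ger0_norm; last by lra.
  by apply: ler_wpM2r; [lra|apply: H; lra].
apply: le_trans (ler_normD _ _) _.
have -> : w * (b - a) = w * ((a + b) / 2 - a) + w * (b - (a + b) / 2) by field.
by apply: lerD; apply: IH; (try by lra); move=> s sab; apply: H; lra.
Qed.

(** The condition on [2 ^ n * d] says that the mesh is at most [d]. On one cell the coarse sum is
    also the fine sum of the constant [c a], so only the oscillation of [c] remains. *)
Lemma riemann_refine V n m (c : R -> V) a b e d : a <= b ->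
  (forall s t, a <= s -> s <= t -> t <= b -> t - s <= d -> `|c t - c s| <= e) ->
  b - a <= 2 ^+ n * d ->
  `|riemann (n + m) c a b - riemann n c a b| <= e * (b - a).
Proof.
elim: n a b => [|n IH] a b ab H.
  rewrite expr0 mul1r add0n /= -(riemann_cst m) -riemannB => bad.
  by apply: riemann_bound => // s /andP[sa sb]; apply: H; lra.
rewrite exprS -mulrA => bad.
rewrite addSn /= opprD addrACA.
apply: le_trans (ler_normD _ _) _.
have -> : e * (b - a) = e * ((a + b) / 2 - a) + e * (b - (a + b) / 2) by field.
apply: lerD; apply: IH; (try by lra); move=> s t *; apply: H; lra.
Qed.

(** The fundamental theorem of calculus for sums: increments of [F] telescope under bisection, and
    the errors on the cells add up to [e * (b - a)]. *)
Lemma riemann_primitive V n (F c : R -> V) a b e d : a <= b ->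
  (forall s t, a <= s -> s <= t -> t <= b -> t - s <= d ->
    `|(t - s) *: c s - (F t - F s)| <= e * (t - s)) ->
  b - a <= 2 ^+ n * d ->
  `|riemann n c a b - (F b - F a)| <= e * (b - a).
Proof.
elim: n a b => [|n IH] a b ab H.
  by rewrite expr0 mul1r => bad; apply: H => //; lra.
rewrite exprS -mulrA => bad /=.
have -> : F b - F a = (F ((a + b) / 2) - F a) + (F b - F ((a + b) / 2)).
  by rewrite [RHS]addrC subrKA.
rewrite opprD addrACA.
apply: le_trans (ler_normD _ _) _.
have -> : e * (b - a) = e * ((a + b) / 2 - a) + e * (b - (a + b) / 2) by field.
apply: lerD; apply: IH; (try by lra); move=> s t *; apply: H; lra.
Qed.

(** [lim] is total; for continuous [c] in a complete space, [cvg_uintegral] shows that it is an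
    actual limit. *)
Definition uintegral V (c : R -> V) : V := lim (riemann n c 0 1 @[n --> \oo]).

Lemma pow2_large (d : R) : 0 < d ->
  exists N, forall n, (N <= n)%N -> 1 - 0 <= 2 ^+ n * d.
Proof.
move=> d0; exists (Num.bound d^-1) => n Nn.
rewrite subr0 -ler_pdivrMr// div1r.
have /ltW/le_trans := archi_boundP (ltW (divr_gt0 ltr01 d0)).
rewrite div1r; apply.
apply: (@le_trans _ _ (n%:R)); first by rewrite ler_nat.
by rewrite -natrX ler_nat ltnW// ltn_expl.
Qed.

Lemma unif_cont_segment V (c : R -> V) e : continuous c -> 0 < e ->
  exists2 d, 0 < d & forall s t, 0 <= s -> s <= t -> t <= 1 -> t - s <= d ->
    `|c t - c s| <= e.
Proof.
move=> cc e0.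
pose P d s := forall t, `|t - s| <= d -> `|c t - c s| <= e.
have [|d d0 H] := @segment_uniform R P.
  move=> s0 _; have e20 : 0 < e / 2 by lra.
  have /cvgrPdist_le /(_ _ e20) /nbhs_normP[r /= r0 Hr] := cc s0.
  exists (r / 2); first by lra.
  move=> s r' ss0 /andP[r'0 r'r] t tr'.
  have A : `|c s0 - c s| <= e / 2 by apply: Hr => /=; rewrite distrC; lra.
  have B : `|c s0 - c t| <= e / 2.
    apply: Hr => /=; rewrite distrC -(subrKA s).
    by apply: le_lt_trans (ler_normD _ _) _; lra.
  rewrite -(subrKA (c s0)); apply: le_trans (ler_normD _ _) _.
  by rewrite [`|c t - c s0|]distrC; lra.
exists d => // s t s0 st t1 tsd; apply: H; first by lra.
by rewrite ger0_norm; lra.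
Qed.

Lemma cvg_uintegral V (c : R -> V) : banach V -> continuous c ->
  riemann n c 0 1 @[n --> \oo] --> uintegral c.
Proof.
move=> bV cc.
suff /(bV _ _)[l Hl] : cauchy (riemann n c 0 1 @[n --> \oo]).
  by apply/cvg_ex; exists l.
apply: cauchy_exP => e e0; have e20 : 0 < e / 2 by lra.
have [d d0 H] := unif_cont_segment cc e20.
have [N HN] := pow2_large d0.
exists (riemann N c 0 1); exists N => // n /= Nn.
rewrite -ball_normE /= distrC -(subnKC Nn).
have := riemann_refine (n - N)%N ler01 H (HN N (leqnn N)).
by rewrite subr0 mulr1; lra.
Qed.

Lemma norm_lim_le V (u : nat -> V) (l v : V) (w : R) :
  u @ \oo --> l ->
  (forall e, 0 < e -> \forall n \near \oo, `|u n - v| <= w + e) ->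
  `|l - v| <= w.
Proof.
move=> ul H; apply/ler_addgt0Pr => e e0; have e20 : 0 < e / 2 by lra.
have /cvgrPdist_le /(_ _ e20) A := ul.
near \oo => n.
have A' : `|l - u n| <= e / 2 by near: n.
have B' : `|u n - v| <= w + e / 2 by near: n; exact: H.
rewrite -(subrKA (u n)); apply: le_trans (ler_normD _ _) _; lra.
Unshelve. all: by end_near. Qed.

Lemma uintegral_linear V k (c d : R -> V) : banach V ->
  continuous c -> continuous d ->
  uintegral (fun s => k *: c s + d s) = k *: uintegral c + uintegral d.
Proof.
move=> bV cc cd; apply/cvg_lim => //.
under eq_fun do rewrite riemann_linear.
apply: cvgD; last exact: cvg_uintegral.
by apply: cvgZl_tmp; exact: cvg_uintegral.
Qed.

Lemma uintegral_pair U V (c : R -> U) (d : R -> V) : banach U -> banach V ->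
  continuous c -> continuous d ->
  uintegral (fun s => (c s, d s)) = (uintegral c, uintegral d).
Proof.
move=> bU bV cc cd; apply/cvg_lim => //.
under eq_fun do rewrite riemann_pair.
by apply: cvg_pair; exact: cvg_uintegral.
Qed.

Lemma uintegral_cst V (v : V) : uintegral (fun=> v) = v.
Proof.
apply/cvg_lim => //; under eq_fun do rewrite riemann_cst subr0 scale1r.
exact: cvg_cst.
Qed.

Lemma uintegral_bound V (c : R -> V) w : banach V -> continuous c ->
  (forall s, 0 <= s <= 1 -> `|c s| <= w) -> `|uintegral c| <= w.
Proof.
move=> bV cc H; rewrite -[uintegral c]subr0.
apply: norm_lim_le (cvg_uintegral bV cc) _ => e e0; near=> n.
rewrite subr0; apply: le_trans (riemann_bound n ler01 H) _.
by rewrite subr0 mulr1; lra.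
Unshelve. all: by end_near. Qed.

(** The hypothesis is a uniform form of [F' = c], with one [d] for the whole interval, as
    [riemann_primitive] requires. *)
Lemma uintegral_primitive V (F c : R -> V) : banach V -> continuous c ->
  (forall e, 0 < e -> exists2 d, 0 < d &
    forall s t, 0 <= s -> s <= t -> t <= 1 -> t - s <= d ->
    `|(t - s) *: c s - (F t - F s)| <= e * (t - s)) ->
  uintegral c = F 1 - F 0.
Proof.
move=> bV cc H; apply/eqP; rewrite -subr_eq0 -normr_le0.
apply: norm_lim_le (cvg_uintegral bV cc) _ => e e0.
have [d d0 Hd] := H e e0; have [N HN] := pow2_large d0.
exists N => // n /= Nn; rewrite add0r.
have := riemann_primitive ler01 Hd (HN n Nn).
by rewrite subr0 mulr1.
Qed.

End Integral.

(** * Means over segments *)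

Section Mean.
Variable R : realType.
Implicit Types U V W X Y : normedModType R.

Lemma smooth_continuous U V (f : U -> V) : smooth f -> continuous f.
Proof.
by move=> sf x; apply: differentiable_continuous; exact: smooth_differentiable.
Qed.

Lemma continuous_on_line U V (f : U -> V) (z y : U) :
  continuous f -> continuous (fun s : R => f (s *: z + y)).
Proof.
move=> cf s; apply: (@continuous_comp _ _ _ (fun s : R => s *: z + y) f);
  last exact: cf.
apply: (@continuousD _ _ _ (fun s : R => s *: z) (fun=> y));
  last exact: cst_continuous.
by apply: cvgZr_tmp; exact: cvg_id.
Qed.

(** The point [(s *: z + y, s *: k + h)] runs along a line in [U * U], on which [Tmap f] is
    continuous. *)
Lemma continuous_diff_on_line U V (f : U -> V) (z y k h : U) : smooth f ->
  continuous (fun s : R => 'd f (s *: z + y) (s *: k + h)).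
Proof.
move=> sf.
have cT := smooth_continuous (smooth_Tmap sf).
apply: (@continuous_on_line _ _ (fun p => (Tmap f p).2) (z, k) (y, h)) => p.
by apply: (@continuous_comp _ _ _ (Tmap f) snd); [exact: cT|exact: cvg_snd].
Qed.

(** Strict differentiability at [s0 *: z + y] covers all nearby base points with one radius;
    compactness then gives a common radius for the segment. *)
Lemma smooth_strict_diff_line U V (f : U -> V) (z y : U) (e : R) :
  smooth f -> 0 < e ->
  exists2 r : R, 0 < r & forall s, 0 <= s <= 1 -> forall h, `|h| < r ->
    `|f (h + (s *: z + y)) - f (s *: z + y) - 'd f (s *: z + y) h| <= e * `|h|.
Proof.
move=> sf e0.
apply: (@segment_uniform R (fun r s => forall h, `|h| < r -> _)) => s0 _.
have [r r0 H] := smooth_strict_diff (s0 *: z + y) sf e0.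
have nz : 0 < `|z| + 1 by rewrite ltr_wpDl.
(* Half of [r] is left for [h] and half for the displacement of the base point; the added [1] keeps
   the divisor positive. *)
pose d := Num.min (r / 2) (r / 2 / (`|z| + 1)).
have d0 : 0 < d by rewrite lt_min !divr_gt0.
exists d => // s r' ss0 /andP[r'0 r'd] h hr'.
have hr : `|h| < r / 2.
  by apply: lt_le_trans (lt_trans hr' r'd) _; rewrite ge_min lexx.
have sz : `|s *: z + y - (s0 *: z + y)| < r / 2.
  rewrite opprD addrACA subrr addr0 -scalerBl normrZ.
  have : `|s - s0| < r / 2 / (`|z| + 1).
    by apply: lt_le_trans ss0 _; rewrite ge_min lexx orbT.
  rewrite ltr_pdivlMr//; apply: le_lt_trans.
  by apply: ler_wpM2l => //; lra.
have := H (s *: z + y) (h + (s *: z + y)); rewrite addrK; apply; first by lra.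
by rewrite -addrA; apply: le_lt_trans (ler_normD _ _) _; lra.
Qed.

(** Near each point of the segment, continuity of the differential bounds its operator norm by
    [K + 1]. The bound is sought as [r^-1] because [segment_uniform] produces small radii. *)
Lemma diff_bounded_line U V (f : U -> V) (z y : U) : smooth f ->
  exists2 K : R, 0 < K & forall s, 0 <= s <= 1 -> forall h,
    `|'d f (s *: z + y) h| <= K * `|h|.
Proof.
move=> sf.
suff [r r0 H] : exists2 r : R, 0 < r & forall s, 0 <= s <= 1 -> forall h,
    `|'d f (s *: z + y) h| <= r^-1 * `|h|.
  by exists r^-1 => //; rewrite invr_gt0.
apply: (@segment_uniform R (fun r s => forall h, _ <= r^-1 * `|h|)) => s0 _.
have [K K0 HK] := diff_bounded (smooth_differentiable (s0 *: z + y) sf).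
have [r r0 H] := smooth_diff_cont (s0 *: z + y) sf ltr01.
have nz : 0 < `|z| + 1 by rewrite ltr_wpDl.
pose d := Num.min (K + 1)^-1 (r / (`|z| + 1)).
have K10 : 0 < K + 1 by lra.
have d0 : 0 < d by rewrite lt_min invr_gt0 K10 divr_gt0.
exists d => // s r' ss0 /andP[r'0 r'd] h.
have sz : `|s *: z + y - (s0 *: z + y)| < r.
  rewrite opprD addrACA subrr addr0 -scalerBl normrZ.
  have : `|s - s0| < r / (`|z| + 1).
    by apply: lt_le_trans ss0 _; rewrite ge_min lexx orbT.
  rewrite ltr_pdivlMr//; apply: le_lt_trans.
  by apply: ler_wpM2l => //; lra.
apply: (@le_trans _ _ ((K + 1) * `|h|)); last first.
  apply: ler_wpM2r => //.
  rewrite -[K + 1]invrK lef_pV2 ?posrE ?invr_gt0//.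
  by apply/ltW/(lt_le_trans r'd); rewrite ge_min lexx.
have := H _ sz h; have := HK h.
set a := 'd f _ h; set b := 'd f _ h => A B.
have -> : b = (b - a) + a by rewrite subrK.
by apply: le_trans (ler_normD _ _) _; lra.
Qed.

(** The operator [M] of the overview, for the segment from [p.1] to [p.1 + p.2]. *)
Definition segment_mean U V (f : U -> V) (p : U * U) : V :=
  uintegral (fun s => f (s *: p.2 + p.1)).

Lemma norm_on_line U (h : U * U) (s : R) : 0 <= s <= 1 ->
  `|s *: h.2 + h.1| <= 2 * `|h|.
Proof.
move=> /andP[s0 s1]; apply: le_trans (ler_normD _ _) _.
rewrite normrZ ger0_norm// prod_normE.
have A : `|h.1| <= Num.max `|h.1| `|h.2| by rewrite le_max lexx.
have B : `|h.2| <= Num.max `|h.1| `|h.2| by rewrite le_max lexx orbT.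
have : s * `|h.2| <= 1 * `|h.2| by apply: ler_wpM2r.
by lra.
Qed.

Lemma uintegralB V (c d : R -> V) : banach V -> continuous c -> continuous d ->
  uintegral (fun s => c s - d s) = uintegral c - uintegral d.
Proof.
move=> bV cc cd; rewrite addrC -scaleN1r -uintegral_linear//.
by congr uintegral; apply/funext => s; rewrite scaleN1r addrC.
Qed.

(** Differentiation under the integral sign: the first-order remainder is uniform along the segment
    by [smooth_strict_diff_line]. The factor [2] in the constants is that of [norm_on_line]. *)
Lemma diff_segment_mean U V (f : U -> V) (p : U * U) : banach V -> smooth f ->
  differentiable (segment_mean f) p /\
  'd (segment_mean f) p =
    (fun h => uintegral (fun s => 'd f (s *: p.2 + p.1) (s *: h.2 + h.1)))
    :> (U * U -> V).
Proof.
move=> bV sf.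
have cd (h : U * U) := @continuous_diff_on_line _ _ f p.2 p.1 h.2 h.1 sf.
have cf z y := @continuous_on_line _ _ f z y (smooth_continuous sf).
have [K K0 HK] := diff_bounded_line p.2 p.1 sf.
apply: (@diff_of_approx _ _ _ _ _ _ (2 * K)).
- move=> a x y.
  rewrite -uintegral_linear; [|exact: bV|exact: (cd x)|exact: (cd y)].
  congr uintegral; apply/funext => s.
  have -> : s *: (a *: x + y).2 + (a *: x + y).1 =
      a *: (s *: x.2 + x.1) + (s *: y.2 + y.1).
    by rewrite /= !scalerDr !scalerA mulrC addrACA.
  exact: linearP.
- move=> h; apply: uintegral_bound => // s s01.
  apply: le_trans (HK s s01 _) _.
  by have := norm_on_line h s01; rewrite -(ler_pM2l K0); lra.
move=> e e0; have e20 : 0 < e / 2 by lra.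
have [r r0 H] := smooth_strict_diff_line p.2 p.1 sf e20.
exists (r / 2); first by lra.
move=> h hr; rewrite /segment_mean.
rewrite -uintegralB; [|exact: bV|exact: cf|exact: cf].
have cB : continuous (fun s : R => f (s *: (h + p).2 + (h + p).1)
    - f (s *: p.2 + p.1)).
  by move=> s; apply: cvgB; exact: cf.
rewrite -uintegralB//.
apply: uintegral_bound => [//||s s01].
  by move=> s; apply: cvgB; [exact: cB|exact: cd].
have hs := norm_on_line h s01.
have -> : s *: (h + p).2 + (h + p).1 = s *: h.2 + h.1 + (s *: p.2 + p.1).
  by rewrite /= scalerDr addrACA.
apply: le_trans (H s s01 _ _) _; first by lra.
by move: hs; rewrite -(ler_pM2l e20); lra.
Qed.

(** The induction is over all [f] at once, as its step passes to [Tmap f], whose values lie in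
    [V * V], complete by [banach_prod]. *)
Lemma smooth_segment_mean U V (f : U -> V) :
  banach V -> smooth f -> smooth (segment_mean f).
Proof.
move=> bV sf n; elim: n U V f bV sf => [//|n IH] U V f bV sf.
split=> [p|]; first by have [] := diff_segment_mean p bV sf.
have -> : Tmap (segment_mean f) = segment_mean (Tmap f) \o @swap4 _ U U U U.
  apply/funext => -[p h]; rewrite /Tmap.
  have [_ ->] := diff_segment_mean p bV sf.
  rewrite /segment_mean /= -uintegral_pair//.
    exact: continuous_on_line (smooth_continuous sf).
  exact: continuous_diff_on_line.
apply: smooth_n_comp; first exact: smooth_n_swap4.
by apply: IH; [exact: banach_prod|exact: smooth_Tmap].
Qed.

Lemma smooth_n_cst n U V (v : V) : smooth_n n (fun _ : U => v).
Proof.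
elim: n U V v => [//|n IH] U V v; split=> [x|]; first exact: differentiable_cst.
have -> : Tmap (fun _ : U => v) = (fun=> (v, 0)).
  by apply/funext => p; rewrite /Tmap diff_cst.
exact: IH.
Qed.

(** The difference quotient [(f (y + t eta) - f y) / t] at [p = (t, (y, eta))],
    extended to [t = 0]. *)
Definition slope U V (f : U -> V) (p : R^o * (U * U)) : V :=
  (segment_mean (Tmap f) (p.2, (p.1 *: p.2.2, 0))).2.

(** Along the segment only the base point of the tangent vector moves, so the integrand keeps the
    direction [p.2.2]. *)
Lemma slopeE U V (f : U -> V) p : banach V -> smooth f ->
  slope f p = uintegral (fun s => 'd f (s *: (p.1 *: p.2.2) + p.2.1) p.2.2).
Proof.
move=> bV sf; rewrite /slope /segment_mean.
have -> : (fun s => Tmap f (s *: (p.1 *: p.2.2, 0) + p.2)) =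
   (fun s => (f (s *: (p.1 *: p.2.2) + p.2.1),
              'd f (s *: (p.1 *: p.2.2) + p.2.1) (s *: 0 + p.2.2))) by [].
rewrite uintegral_pair//=.
- by congr uintegral; apply/funext => s; rewrite scaler0 add0r.
- exact: continuous_on_line (smooth_continuous sf).
exact: continuous_diff_on_line.
Qed.

Lemma smooth_slope U V (f : U -> V) : banach V -> smooth f -> smooth (slope f).
Proof.
move=> bV sf n; rewrite /slope.
apply: (@smooth_n_comp _ n _ _ _ (fun p => segment_mean (Tmap f) _) snd);
  last first.
  exact: smooth_n_snd.
apply: (@smooth_n_comp _ n _ _ _
  (fun p : R^o * (U * U) => (p.2, (p.1 *: p.2.2, 0))) (segment_mean (Tmap f))).
  apply: smooth_n_pair; first exact: smooth_n_snd.
  apply: smooth_n_pair; last exact: smooth_n_cst.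
  apply: (@smooth_n_comp _ n _ _ _ (fun p : R^o * (U * U) => (p.1, p.2.2))
    (fun p : R^o * U => p.1 *: p.2)); last exact: smooth_n_scale.
  apply: smooth_n_pair; first exact: smooth_n_fst.
  by apply: (@smooth_n_comp _ n _ _ _ snd snd); exact: smooth_n_snd.
by apply: smooth_segment_mean; [exact: banach_prod|exact: smooth_Tmap].
Qed.

Lemma slope0 U V (f : U -> V) p : banach V -> smooth f ->
  slope f (0, p) = 'd f (p.1) p.2.
Proof.
move=> bV sf; rewrite slopeE//= -[RHS]uintegral_cst.
by congr uintegral; apply/funext => s; rewrite scale0r scaler0 add0r.
Qed.

(** By linearity [t] moves inside the integral, whose integrand becomes the derivative of
    [s |-> f (s *: z + p.1)]; [uintegral_primitive] concludes. *)
Lemma scale_slope U V (f : U -> V) t (p : U * U) : banach V -> smooth f ->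
  t *: slope f (t, p) = f (t *: p.2 + p.1) - f p.1.
Proof.
move=> bV sf; rewrite slopeE//=; set z := t *: p.2.
have cz v : continuous (fun s : R => 'd f (s *: z + p.1) v).
  have := @continuous_diff_on_line _ _ f z p.1 0 v sf.
  by under eq_fun do rewrite scaler0 add0r.
transitivity (uintegral (fun s => 'd f (s *: z + p.1) z)).
  rewrite -[LHS]addr0 -[X in _ + X](@uintegral_cst R V).
  rewrite -uintegral_linear//; last first.
    by move=> s; exact: cvg_cst.
  by congr uintegral; apply/funext => s; rewrite addr0 /z -linearZZ.
rewrite (@uintegral_primitive _ _ (fun s => f (s *: z + p.1)))//.
  by rewrite scale1r scale0r add0r.
move=> e e0.
have nz : 0 < `|z| + 1 by rewrite ltr_wpDl.
(* The divisor absorbs the length of [(u - s) *: z], so that the remainder is at most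
   [e * (u - s)]. *)
have e'0 : 0 < e / (`|z| + 1) by rewrite divr_gt0.
have [r r0 H] := smooth_strict_diff_line z p.1 sf e'0.
exists (r / 2 / (`|z| + 1)); first by rewrite !divr_gt0.
move=> s u s0 su u1 usd.
have us0 : 0 <= u - s by lra.
have nuz : `|(u - s) *: z| <= (u - s) * (`|z| + 1).
  by rewrite normrZ ger0_norm//; apply: ler_wpM2l => //; lra.
have uz : `|(u - s) *: z| < r.
  by move: usd; rewrite ler_pdivlMr//; lra.
have s01 : 0 <= s <= 1 by lra.
have := H s s01 _ uz; rewrite addrA -scalerDl subrK ['d f _ _]linearZ distrC.
move=> /le_trans; apply.
rewrite mulrAC ler_pdivrMr// -mulrA.
by apply: ler_wpM2l => //; lra.
Qed.

End Mean.

(** * Slope fields *)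

Section Slope.
Variable R : realType.
Implicit Types U V W X Y : normedModType R.

(** The field [G_t] of the overview. *)
Definition slope_field Y (f : Y -> Y) (t : R) (p : Y * Y) : Y * Y :=
  (f p.1, slope f (t, p)).

Lemma smooth_family_slope_field Y (f : Y -> Y) :
  banach Y -> smooth f -> smooth_family (slope_field f).
Proof.
move=> bY sf n; apply: smooth_n_pair; last first.
  by have := smooth_slope bY sf n; congr smooth_n; apply/funext => -[].
apply: (@smooth_n_comp _ n _ _ _ (fun p : R^o * (Y * Y) => p.2.1) f) => //.
by apply: (@smooth_n_comp _ n _ _ _ snd fst);
  [exact: smooth_n_snd|exact: smooth_n_fst].
Qed.

Lemma smooth_slope_field Y (f : Y -> Y) t :
  banach Y -> smooth f -> smooth (slope_field f t).
Proof.
move=> bY sf n.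
apply: (smooth_n_comp (smooth_n_pair (@smooth_n_cst R n (Y * Y)%type R^o t) _)
  (smooth_family_slope_field bY sf n)).
by apply: smooth_n_linear => // p; exact: cvg_id.
Qed.

Lemma slope_field0 Y (f : Y -> Y) :
  banach Y -> smooth f -> slope_field f 0 = delta f.
Proof.
by move=> bY sf; apply/funext => p; rewrite /slope_field slope0.
Qed.

Lemma is_linear_translate Y (t : R) :
  is_linear (fun p : Y * Y => t *: p.2 + p.1).
Proof.
by move=> a x y /=; rewrite !scalerDr !scalerA mulrC addrACA.
Qed.

Lemma continuous_translate Y (t : R) :
  continuous (fun p : Y * Y => t *: p.2 + p.1).
Proof.
move=> p; apply: cvgD; last exact: cvg_fst.
by apply: cvgZl_tmp; exact: cvg_snd.
Qed.

Lemma related_translate Y (t : R) (F : Y * Y -> Y * Y) (g : Y -> Y) :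
  related (fun p : Y * Y => t *: p.2 + p.1) F g <->
  (forall p, t *: (F p).2 + (F p).1 = g (t *: p.2 + p.1)).
Proof.
have D (p : Y * Y) := continuous_linear_diff p (is_linear_translate t)
  (@continuous_translate Y t).
by split=> H p; have := H p; have [_ ->] := D p.
Qed.

(** [e = 0] gives the projection to the base point and [e = t] the translated point, so one family
    of maps serves both relations. *)
Lemma related_slope_field Y (f : Y -> Y) (e t : R) : banach Y -> smooth f ->
  e = 0 \/ e = t ->
  related (fun p : Y * Y => e *: p.2 + p.1) (slope_field f t) f.
Proof.
move=> bY sf et; apply/related_translate => p /=.
case: et => ->; first by rewrite !scale0r !add0r.
by rewrite scale_slope// subrK.
Qed.

(** For [t != 0] the two relations force the second component of [F t] to be the difference quotient
    of [g]; continuity in [t] settles [t = 0]. Stating this for any [F] serves the additive and the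
    partitioned case alike. *)
Lemma delta_unique Y (g : Y -> Y) (F : R -> Y * Y -> Y * Y) :
  smooth g -> smooth_family F ->
  (forall e t, e = 0 \/ e = t ->
    related (fun p : Y * Y => e *: p.2 + p.1) (F t) g) ->
  F 0 = delta g.
Proof.
move=> sg sF H.
have F1 t p : (F t p).1 = g p.1.
  by have /related_translate/(_ p) := H 0 t (or_introl erefl);
    rewrite !scale0r !add0r.
have F2 t p : t *: (F t p).2 = g (t *: p.2 + p.1) - g p.1.
  have /related_translate/(_ p) <- := H t t (or_intror erefl).
  by rewrite F1 addrK.
apply/funext => p; rewrite [LHS]surjective_pairing /delta /Tmap F1; congr pair.
have dg := smooth_differentiable p.1 sg.
rewrite -deriveE// /derive; apply/esym/cvg_lim => //.
have c0 : (F t p).2 @[t --> (0 : R)] --> (F 0 p).2.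
  have cF := smooth_continuous sF.
  have cf : continuous (fun t : R^o => (F t p).2).
    move=> t.
    apply: (@continuous_comp _ _ _ (fun t => F t p) snd); last exact: cvg_snd.
    apply: (@continuous_comp _ _ _ (fun t : R^o => (t, p))
      (fun q : R^o * (Y * Y) => F q.1 q.2)); last exact: cF.
    by apply: continuous_pair => ?; [exact: cvg_id|exact: cvg_cst].
  exact: cf.
(* The difference quotient makes sense only for [t != 0], hence the punctured neighbourhoods. *)
have {}c0 : (F t p).2 @[t --> (0 : R)^'] --> (F 0 p).2.
  exact: cvg_within_filter c0.
apply: cvg_trans c0; apply: near_eq_cvg; near=> t.
have t0 : t != 0 by near: t; exact: nbhs_dnbhs_neq.
by rewrite /= -F2 scalerA mulVf// scale1r.
Unshelve. all: by end_near. Qed.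

Lemma is_partition_pair N Y (P : 'I_N -> Y -> Y) :
  is_partition P -> is_partition (partition_pair P).
Proof.
move=> [lcP PP sP]; split.
- move=> i; have [lP cP] := lcP i; split.
    by move=> a x y; rewrite /partition_pair /= !lP.
  by apply: continuous_pair;
  [exact: continuous_comp_fst|exact: continuous_comp_snd].
- by move=> i j x; rewrite /partition_pair /= !PP; case: eqP.
move=> x.
have S n (G : 'I_n -> Y) (K : 'I_n -> Y) :
    \sum_(i < n) (G i, K i) = (\sum_(i < n) G i, \sum_(i < n) K i) :> Y * Y.
  by elim/big_rec3: _ => // i a b c _ ->.
by rewrite /partition_pair S !sP -surjective_pairing.
Qed.

End Slope.

Theorem theorem4p18 (R : realType) (N : nat) :
  (forall phi : additive_map R N,
     additive_integrator_map phi -> N_affine_equivariant phi ->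
     forall Y : normedModType R, banach Y ->
     forall f : 'I_N -> Y -> Y, (forall i, smooth (f i)) ->
       phi (Y * Y)%type (fun i => delta (f i)) = delta (phi Y f))
  /\
  (forall phi : partitioned_map R N,
     partitioned_integrator_map phi -> P_affine_equivariant phi ->
     forall (Y : normedModType R) (P : 'I_N -> Y -> Y),
       banach Y -> is_partition P ->
     forall f : Y -> Y, smooth f ->
       phi (Y * Y)%type (partition_pair P) (delta f) = delta (phi Y P f)).
Proof.
split=> phi smooth_phi eq_phi Y.
  move=> bY f sf; have bYY := banach_prod bY bY.
  have -> : (fun i => delta (f i)) = (fun i => slope_field (f i) 0).
    by apply/funext => i; rewrite slope_field0.
  (* The family consists of the images of the slope fields under [phi]; its value at [0] is the
     left-hand side. *)
  apply: (@delta_unique _ _ _ (fun t => phi _ (fun i => slope_field (f i) t))).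
  - exact: (smooth_phi Y bY).1.
  - apply: (smooth_phi _ bYY).2 => i; exact: smooth_family_slope_field.
  move=> e t et; apply: eq_phi => //.
  - exists (fun p : Y * Y => e *: p.2 + p.1); split.
    + exact: is_linear_translate.
    + exact: continuous_translate.
    by exists 0 => p; rewrite addr0.
  - by move=> i; exact: smooth_slope_field.
  by move=> i; exact: related_slope_field.
move=> P bY pP f sf; have bYY := banach_prod bY bY.
have pPP := is_partition_pair pP.
rewrite -slope_field0//.
apply: (@delta_unique _ _ _
  (fun t => phi _ (partition_pair P) (slope_field f t))).
- exact: (smooth_phi Y P bY pP).1.
- by apply: (smooth_phi _ _ bYY pPP).2; exact: smooth_family_slope_field.
move=> e t et; apply: eq_phi => //.
- exists (fun p : Y * Y => e *: p.2 + p.1); split.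
  + exact: is_linear_translate.
  + exact: continuous_translate.
  (* The map acts on each summand separately, since [e] is a scalar and [P i] is linear. *)
  + by move=> i x; have [/(_ i)[lP _] _ _] := pP; rewrite /partition_pair /= lP.
  by exists 0 => p; rewrite addr0.
- exact: smooth_slope_field.
exact: related_slope_field.
Qed.
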